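(* Let $f(X)=a_{0}+a_{1}X+\cdots +a_{n}X^{n}\in \mathbb{Z}[X]$, $a_{0}a_{n}\neq 0$. Suppose there exist two distinct prime numbers $p,q$ and two distinct indices $j_{1},j_{2}\in\{0,\dots ,n\}$ such that $j_{1}<\min(j_{2},n-j_{2})$ and (i) $\nu _{p}(a_{i})=0$ for all $0\le i\leq j_{1}$, $\frac{\nu _{p}(a_{i})}{i-j_{1}}>\frac{\nu _{p}(a_{n})}{n-j_{1}}$ for $j_{1}<i<n$, and $\nu _{p}(a_{n})>0$; (ii) $\nu _{q}(a_{0}) = 0$; $\frac{\nu _{q}(a_{i})}{i} > \frac{\nu _{q}(a_{j_{2}})}{j_{2}}$ for $0<i<j_{2}$; $\nu _{q}(a_{j_{2}})>0$; $\nu _{q}(a_{i}) > \frac{n-i}{n-j_{2}}\, \nu _{q}(a_{j_{2}})+\frac{i-j_{2}}{n-j_{2}}\, \nu _{q}(a_{n})$ for $j_{2}<i<n$; and $\frac{\nu _{q}(a_{n})}{n}>\frac{\nu _{q}(a_{j_{2}})}{j_{2}}$; (iii) $\gcd(\nu _{p}(a_{n}),n-j_{1})=\gcd(\nu _{q}(a_{j_{2}}),j_{2})=\gcd(\nu _{q}(a_{n})-\nu _{q}(a_{j_{2}}),n-j_{2})=1$. Then $f$ is irreducible over $\mathbb{Q}$.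
   Context: For a prime $p$ and a nonzero integer $m$, $\nu_p(m)$ is the largest integer $i$ such that $p^i\mid m$; by convention $\nu_p(0)=\infty$ (so lower bounds on $\nu_p(a_i)$ hold automatically when $a_i=0$). *)

(* Defs.v *)
From mathcomp Require Import all_boot all_order all_algebra.
From mathcomp Require Import constructive_ereal.

Set Implicit Arguments.
Unset Strict Implicit.
Unset Printing Implicit Defensive.

Import GRing.Theory.

Local Open Scope ring_scope.

Definition intval (p : nat) (m : int) : nat := logn p `|m|%N.

(* Pitfall: [intval p 0 = 0] since [logn p 0 = 0], so [intval] is the p-adic
   valuation on nonzero integers only; [nu] extends it by [nu p 0 = +oo]. *)
Definition nu (p : nat) (m : int) : \bar rat :=
  if m == 0 then +oo%E else ((intval p m)%:R)%:E.

Definition int_poly (a : nat -> int) (n : nat) : {poly int} :=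
  \sum_(i < n.+1) (a i)%:P * 'X^i.

Definition irreducible_over_rat (f : {poly int}) : Prop :=
  irreducible_poly (map_poly intr f : {poly rat}).

(* Main.v *)
(* Newton polygons, phrased over the integers: for a slope [M / K], the set of
   indices minimizing [K v(g_i) - M i] has a first and a last element, and both
   are additive in products. If the index distance of an edge is [K] with
   [gcd(K, M) = 1], a factorization leaves the whole edge in one factor.
   At [p] the edge from [j1] to [n] thus forces one factor to have degree at
   most [j1]. At [q] the polygon consists of two such edges, of lengths [j2] and
   [n - j2], both larger than [j1], so a factor of degree at most [j1] takes
   part in neither of them and is constant. *)
Require Import Defs.
From mathcomp Require Import all_boot all_order all_algebra.
From mathcomp Require Import constructive_ereal.
From mathcomp Require Import zify.

Import Order.TTheory GRing.Theory Num.Theory.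

Local Open Scope ring_scope.

(** * Valuations of sums and products of integers *)

Lemma intvalM (p : nat) (x y : int) :
  x != 0 -> y != 0 -> intval p (x * y) = (intval p x + intval p y)%N.
Proof. by move=> x0 y0; rewrite /intval abszM lognM ?absz_gt0. Qed.

Lemma dvdz_intval (p k : nat) (x : int) :
  prime p -> x != 0 -> ((p ^ k)%N%:Z %| x)%Z = (k <= intval p x)%N.
Proof. by move=> pp x0; rewrite dvdzE /= pfactor_dvdn ?absz_gt0. Qed.

(** Otherwise [p ^ e.+1] would divide every term, hence the sum, whose valuation is only [e]. *)
Lemma exists_intval_le_sum (p : nat) (I : finType) (P : pred I) (F : I -> int) :
  prime p -> \sum_(i | P i) F i != 0 ->
  exists i, [/\ P i, F i != 0 &
    (intval p (F i) <= intval p (\sum_(i | P i) F i))%N].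
Proof.
move=> pp; set S := \sum_(i | P i) F i => S0; set e := intval p S.
suff /existsP[i /and3P[Pi Fi le]] :
    [exists i, [&& P i, F i != 0 & (intval p (F i) <= e)%N]] by exists i.
apply: contraT => /existsPn H.
suff: ((p ^ e.+1)%N%:Z %| S)%Z by rewrite dvdz_intval // ltnn.
apply: rpred_sum => i Pi; have := H i; rewrite Pi /=.
have [-> _|Fi /=] := eqVneq (F i) 0; first exact: dvdz0.
by rewrite -ltnNge dvdz_intval.
Qed.

Lemma intval_add_gt (p : nat) (x y : int) :
  prime p -> x != 0 -> (y != 0 -> (intval p x < intval p y)%N) ->
  x + y != 0 /\ intval p (x + y) = intval p x.
Proof.
move=> pp x0 xy; have [->|y0] := eqVneq y 0; first by rewrite addr0.
have {xy} lt := xy y0.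
have ndvd : ~~ ((p ^ (intval p x).+1)%N%:Z %| x + y)%Z.
  by rewrite rpredDr dvdz_intval ?ltnn.
have xy0 : x + y != 0 by apply: contraNneq ndvd => ->; exact: dvdz0.
split=> //; apply/eqP; rewrite eqn_leq leqNgt -dvdz_intval // ndvd /=.
by rewrite -dvdz_intval // rpredD ?dvdz_intval // ltnW.
Qed.

(** A convolution term strictly below all others in valuation decides the valuation of the sum. Zero
    factors are excluded because [intval p 0] is [0], not infinite. *)
Lemma intval_coefM_corner (p : nat) (g h : {poly int}) (l m : nat) :
  prime p -> g`_l != 0 -> h`_m != 0 ->
  (forall i j, (i + j = l + m)%N -> i != l -> g`_i != 0 -> h`_j != 0 ->
     (intval p g`_l + intval p h`_m < intval p g`_i + intval p h`_j)%N) ->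
  (g * h)`_(l + m) != 0 /\
  intval p (g * h)`_(l + m) = (intval p g`_l + intval p h`_m)%N.
Proof.
move=> pp gl hm lt; rewrite coefM.
have llm : (l < (l + m).+1)%N by rewrite ltnS leq_addr.
rewrite (bigD1 (Ordinal llm)) //= addKn -intvalM //.
apply: intval_add_gt => //; first by rewrite mulf_neq0.
move=> /exists_intval_le_sum -/(_ _ pp)[i [il]].
rewrite mulf_eq0 negb_or => /andP[gi hi]; apply: leq_trans.
rewrite !intvalM //; apply: lt => //.
by rewrite subnKC // -ltnS.
Qed.

(** * Edges of Newton polygons and their behaviour in products *)

(** This is [K] times the height of a Newton point above the line of slope [M / K] through the
    origin; clearing the denominator keeps it in [int]. *)
Definition npweight (p K : nat) (M : int) (g : {poly int}) (i : nat) : int :=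
  K%:Z * (intval p g`_i)%:Z - M * i%:Z.

(* The points of the Newton polygon of [g] lying on its supporting line of
   slope [M / K] have extreme abscissas [L] and [U]; this is a vertex when
   [L = U]. *)
Definition npedge (p K : nat) (M : int) (g : {poly int}) (L U : nat) : Prop :=
  [/\ g`_L != 0, g`_U != 0, npweight p K M g L = npweight p K M g U &
   forall i, g`_i != 0 ->
   [/\ npweight p K M g L <= npweight p K M g i,
       (i < L)%N -> npweight p K M g L < npweight p K M g i &
       (U < i)%N -> npweight p K M g L < npweight p K M g i]].

Lemma npedge_uniq (p K : nat) (M : int) (g : {poly int}) (L U L' U' : nat) :
  npedge p K M g L U -> npedge p K M g L' U' -> L = L' /\ U = U'.
Proof.
case=> gL gU E H [gL' gU' E' H'].
have [a1 a2 a3] := H _ gL'; have [b1 b2 b3] := H _ gU'.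
have [c1 c2 c3] := H' _ gL; have [d1 d2 d3] := H' _ gU.
by split; apply/eqP; rewrite eqn_leq leqNgt [X in _ && X]leqNgt;
  apply/andP; split; apply/negP => lt;
  [move: (a2 lt)|move: (c2 lt)|move: (d3 lt)|move: (b3 lt)]; lia.
Qed.

Lemma npedge_exists (p K : nat) (M : int) (g : {poly int}) :
  g != 0 -> exists L U, (L <= U)%N /\ npedge p K M g L U.
Proof.
move=> g0; pose w := npweight p K M g.
have sg : (0 < size g)%N by rewrite size_poly_gt0.
have lg : ((size g).-1 < size g)%N by rewrite prednK.
have g1 : g`_(Ordinal lg) != 0 by rewrite /= -lead_coefE lead_coef_eq0.
case: (@arg_minP _ _ _ (Ordinal lg) (fun i => g`_(val i) != 0)
  (fun i => w (val i))) => //= m gm mmin.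
pose Q i := (g`_i != 0) && (w i == w m).
have exQ : exists i, Q i by exists m; rewrite /Q gm /=.
have nz i : g`_i != 0 -> (i < size g)%N.
  by apply: contra_neqT; rewrite -leqNgt => /leq_sizeP->.
have leQ i : Q i -> (i <= size g)%N by case/andP=> /nz/ltnW.
have [L /andP[gL /eqP wL] Lmin] := ex_minnP exQ.
have [U /andP[gU /eqP wU] Umax] := ex_maxnP exQ leQ.
exists L, U; split; first by apply: Lmin; rewrite /Q gU wU /=.
split=> //; rewrite -/w ?wL ?wU // => i gi.
have le : w m <= w i := mmin (Ordinal (nz _ gi)) gi.
split=> // lt; rewrite lt_neqAle le andbT; apply: contraTneq lt => wi.
  by rewrite -leqNgt; apply: Lmin; rewrite /Q gi -wi /=.
by rewrite -leqNgt; apply: Umax; rewrite /Q gi -wi /=.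
Qed.

(** Weights add in products. At [L + L'] only the pair [(L, L')] attains the minimum, since any
    other pair with that sum has [i < L] or [j < L']; symmetrically at [U + U']. *)
Lemma npedgeM (p K : nat) (M : int) (g h : {poly int}) (L U L' U' : nat) :
  prime p -> (0 < K)%N -> npedge p K M g L U -> npedge p K M h L' U' ->
  npedge p K M (g * h) (L + L') (U + U').
Proof.
move=> pp K0 [gL gU E H] [hL hU E' H'].
move: E E' H H'; rewrite /npweight => E E' H H'.
have [nL vL] : (g * h)`_(L + L') != 0 /\
    intval p (g * h)`_(L + L') = (intval p g`_L + intval p h`_L')%N.
  apply: intval_coefM_corner => // i j ij iL gi hj.
  have Mij : M * (i + j)%N%:Z = M * (L + L')%N%:Z by rewrite ij.
  have [a1 a2 a3] := H _ gi; have [b1 b2 b3] := H' _ hj.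
  rewrite -(ltn_pmul2l K0).
  by have [/a2|/b2] : (i < L)%N \/ (j < L')%N by [lia]; lia.
have [nU vU] : (g * h)`_(U + U') != 0 /\
    intval p (g * h)`_(U + U') = (intval p g`_U + intval p h`_U')%N.
  apply: intval_coefM_corner => // i j ij iL gi hj.
  have Mij : M * (i + j)%N%:Z = M * (U + U')%N%:Z by rewrite ij.
  have [a1 a2 a3] := H _ gi; have [b1 b2 b3] := H' _ hj.
  rewrite -(ltn_pmul2l K0).
  by have [/a3|/b3] : (U < i)%N \/ (U' < j)%N by [lia]; lia.
split=> //; first by rewrite /npweight vL vU; lia.
move=> k; rewrite /npweight {1}coefM => /exists_intval_le_sum -/(_ _ pp)[i [_]].
rewrite mulf_eq0 negb_or -coefM => /andP[gi hi]; rewrite intvalM //.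
rewrite -(leq_pmul2l K0) vL => le; have := ltn_ord i; rewrite ltnS => ik.
have [j jE Ek] : exists2 j, (k - i)%N = j & (i + j)%N = k.
  by exists (k - i)%N => //; rewrite subnKC.
rewrite jE in hi le; move: le; move: (intval p (g * h)`_k) => v le.
have Mk : M * (i + j)%N%:Z = M * k%:Z by rewrite Ek.
have [a1 a2 a3] := H _ gi; have [b1 b2 b3] := H' _ hi.
split=> [|lt|lt]; first by lia.
  by have [/a2|/b2] : (i < L)%N \/ (j < L')%N by [lia]; lia.
by have [/a3|/b3] : (U < i)%N \/ (U' < j)%N by [lia]; lia.
Qed.

Lemma npedge_lt_size (p K : nat) (M : int) (g : {poly int}) (L U : nat) :
  npedge p K M g L U -> (U < size g)%N.
Proof.
by case=> _ gU _ _; apply: contraNT gU; rewrite -leqNgt => /leq_sizeP->.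
Qed.

(* A primitive edge contains no lattice points besides its ends, so it cannot
   be shared between two factors. *)
Lemma npedge_factor (p K : nat) (M : int) (g h : {poly int}) (l : nat) :
  prime p -> (0 < K)%N -> coprimez K%:Z M -> npedge p K M (g * h) l (l + K) ->
  exists L U L' U', [/\ npedge p K M g L U, npedge p K M h L' U',
    (L + L' = l)%N, (U + U' = l + K)%N & U = L \/ U' = L'].
Proof.
move=> pp K0 coKM Ef; have [fl _ _ _] := Ef.
have : g * h != 0 by apply: contraNneq fl => ->; rewrite coef0.
rewrite mulf_eq0 negb_or => /andP[g0 h0].
have [L [U [LU Eg]]] := @npedge_exists p K M g g0.
have [L' [U' [LU' Eh]]] := @npedge_exists p K M h h0.
have [eL eU] := npedge_uniq _ _ _ _ _ _ _ _ Ef (npedgeM _ _ _ _ _ _ _ _ _ pp K0 Eg Eh).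
exists L, U, L', U'; split=> //.
(* Equal weights at both ends say that [M * (U - L)] is [K] times a difference of valuations. *)
have : (K%:Z %| (U - L)%N%:Z * M)%Z.
  case: Eg => _ _ + _; rewrite /npweight -subzn // => E.
  apply/dvdzP; exists ((intval p g`_U)%:Z - (intval p g`_L)%:Z); lia.
rewrite Gauss_dvdzl // dvdzE /= => /dvdnP[t Et].
(* The two widths [U - L] and [U' - L'] add up to [K], so the multiple [t] of [K] is [0] or [1]. *)
case: t Et => [|[|t]] Et; first by left; lia.
  by right; lia.
by nia.
Qed.

(** Exchange argument: a steeper slope cannot move the minimizer to the left. Scaling the two
    minimality inequalities by [K2] and [K1] and adding them cancels [x] and [y]. *)
Lemma argmin_slope_monotone (K1 K2 : nat) (M1 M2 x y u l : int) :
  (0 < K1)%N -> (0 < K2)%N -> M1 * K2%:Z < M2 * K1%:Z -> l < u ->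
  K1%:Z * x - M1 * u <= K1%:Z * y - M1 * l ->
  K2%:Z * y - M2 * l <= K2%:Z * x - M2 * u -> False.
Proof.
move=> K10 K20 lt12 lul a1 a2.
have c1 : K2%:Z * (K1%:Z * x - M1 * u) <= K2%:Z * (K1%:Z * y - M1 * l).
  by rewrite ler_wpM2l.
have c2 : K1%:Z * (K2%:Z * y - M2 * l) <= K1%:Z * (K2%:Z * x - M2 * u).
  by rewrite ler_wpM2l.
have : (M1 * K2%:Z) * (u - l) < (M2 * K1%:Z) * (u - l).
  by rewrite ltr_pM2r // subr_gt0.
clear -c1 c2; lia.
Qed.

(* A factor of degree smaller than both edge lengths contains neither edge, so
   its polygon shifts the common vertex [K1] of the two edges by [0] on the
   first one and by its degree on the second one. *)
Lemma size_factor_two_edges (p K1 K2 : nat) (M1 M2 : int) (g h : {poly int}) :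
  prime p -> (0 < K1)%N -> (0 < K2)%N ->
  coprimez K1%:Z M1 -> coprimez K2%:Z M2 -> M1 * K2%:Z < M2 * K1%:Z ->
  npedge p K1 M1 (g * h) 0 K1 -> npedge p K2 M2 (g * h) K1 (K1 + K2) ->
  size (g * h) = (K1 + K2).+1 -> (size h <= K1)%N -> (size h <= K2)%N ->
  size h = 1%N.
Proof.
move=> pp K10 K20 co1 co2 lt12 E1 E2 sf hK1 hK2.
have [L1 [U1 [L1' [U1' [Eg1 Eh1 e1 e1' d1]]]]] :=
  npedge_factor _ _ _ _ _ _ pp K10 co1 E1.
have [L2 [U2 [L2' [U2' [Eg2 Eh2 e2 e2' d2]]]]] :=
  npedge_factor _ _ _ _ _ _ pp K20 co2 E2.
have sg1 := npedge_lt_size _ _ _ _ _ _ Eg1.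
have sh1 := npedge_lt_size _ _ _ _ _ _ Eh1.
have sg2 := npedge_lt_size _ _ _ _ _ _ Eg2.
have sh2 := npedge_lt_size _ _ _ _ _ _ Eh2.
have g0 : g != 0 by rewrite -size_poly_gt0; apply: leq_ltn_trans sg1.
have h0 : h != 0 by rewrite -size_poly_gt0; apply: leq_ltn_trans sh1.
move: sf; rewrite size_mul // => sf.
have leUL : (U1 <= L2)%N.
  rewrite leqNgt; apply/negP => lt.
  case: Eg1 => _ gU1 e1U H1; case: Eg2 => gL2 _ _ H2.
  have [a1 _ _] := H1 _ gL2; have [a2 _ _] := H2 _ gU1.
  move: a1 a2; rewrite e1U /npweight.
  move: (intval p g`_U1) (intval p g`_L2) => x y.
  exact: (argmin_slope_monotone K1 K2 M1 M2 x%:Z y%:Z U1%:Z L2%:Z).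
(* Being too short for either edge, [h] has [L1' = U1'] and [L2' = U2']. Then [L1' = 0] and
   [U1 = K1], so [leUL] forces [L2 = K1] and [U2 = K1 + K2]: the whole degree lies in [g]. *)
move: leUL sf sg1 sh1 sg2 sh2 e1 e1' d1 e2 e2' d2 hK1 hK2; clear.
move: (size g) (size h) => sg sh; lia.
Qed.

(** * From extended rational valuations to integer inequalities *)

Lemma nu_fin (p : nat) (x : int) : x != 0 -> nu p x = ((intval p x)%:R%:E)%E.
Proof. by rewrite /nu => /negbTE->. Qed.

Lemma ltr_divn (x y k l : nat) : (0 < k)%N -> (0 < l)%N ->
  (x%:R%:E / k%:R%:E < y%:R%:E / l%:R%:E :> \bar rat)%E = (x * l < y * k)%N.
Proof.
move=> k0 l0; rewrite !inver !pnatr_eq0 !gtn_eqF // -!EFinM lte_fin.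
by rewrite ltr_pdivrMr ?ltr0n // mulrAC ltr_pdivlMr ?ltr0n // -!natrM ltr_nat.
Qed.

Lemma coef_int_poly (a : nat -> int) (n i : nat) :
  (int_poly a n)`_i = if (i <= n)%N then a i else 0.
Proof.
rewrite /int_poly (eq_bigr (fun i : 'I_n.+1 => a i *: 'X^i)) => [|j _].
  by rewrite -poly_def coef_poly ltnS.
by rewrite mul_polyC.
Qed.

Lemma size_int_poly (a : nat -> int) (n : nat) :
  a n != 0 -> size (int_poly a n) = n.+1.
Proof.
move=> an; apply/eqP; rewrite eqn_leq; apply/andP; split.
  by apply/leq_sizeP => i ni; rewrite coef_int_poly leqNgt ni.
rewrite ltnNge; apply: contraNN an => /leq_sizeP/(_ n (leqnn n)).
by rewrite coef_int_poly leqnn => ->.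
Qed.

Lemma npedgeI (p K : nat) (M : int) (g : {poly int}) (L U : nat) :
  (L <= U)%N -> g`_L != 0 -> g`_U != 0 ->
  npweight p K M g L = npweight p K M g U ->
  (forall i, g`_i != 0 -> i != L -> i != U ->
     npweight p K M g L < npweight p K M g i) ->
  npedge p K M g L U.
Proof.
move=> LU gL gU wLU lt; split=> // i gi.
have [->|iL] := eqVneq i L; first by rewrite ltnn ltnNge LU; split.
have [->|iU] := eqVneq i U; first by rewrite wLU ltnn [(U < L)%N]ltnNge LU; split.
by have wi := lt i gi iL iU; split=> //; apply: ltW.
Qed.

Lemma ltr_nat_interpol (s d k v w x : nat) : (0 < k)%N ->
  ((s%:R / k%:R)%:E * v%:R%:E + (d%:R / k%:R)%:E * w%:R%:E
     < x%:R%:E :> \bar rat)%E = (s * v + d * w < x * k)%N.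
Proof.
move=> k0; rewrite -!EFinM -EFinD lte_fin mulrAC [_ / _ * w%:R]mulrAC -mulrDl.
by rewrite ltr_pdivrMr ?ltr0n // -!natrM -natrD ltr_nat.
Qed.

Lemma npedge_int_poly (p K : nat) (M : int) (a : nat -> int) (n L U : nat) :
  (L <= U <= n)%N -> a L != 0 -> a U != 0 ->
  K%:Z * (intval p (a L))%:Z - M * L%:Z = K%:Z * (intval p (a U))%:Z - M * U%:Z ->
  (forall i, (i <= n)%N -> a i != 0 -> i != L -> i != U ->
     K%:Z * (intval p (a L))%:Z - M * L%:Z < K%:Z * (intval p (a i))%:Z - M * i%:Z) ->
  npedge p K M (int_poly a n) L U.
Proof.
case/andP=> LU Un aL aU wLU lt; have Ln := leq_trans LU Un.
apply: npedgeI; rewrite /npweight ?coef_int_poly ?Ln ?Un // => i.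
by rewrite coef_int_poly; case: (leqP i n) => [ni|_]; [exact: (lt i ni)|rewrite eqxx].
Qed.

(** The point [(j + d, x)] is above the chord from [(j, v)] to [(j + d + s, w)]. That chord starts
    on the line of slope [v / j] through the origin and ends above it. *)
Lemma edge_beyond_first (v w s d j x : nat) :
  (s * v + d * w < x * (s + d))%N -> (v * (j + d + s) < w * j)%N -> (0 < d)%N ->
  (v * (j + d) < j * x)%N.
Proof.
move=> lt1 lt2 d0.
have c1 : (j * (s * v + d * w) <= j * (x * (s + d)))%N by rewrite leq_mul2l ltnW ?orbT.
have c2 : (d * (v * (j + d + s)) < d * (w * j))%N by rewrite ltn_pmul2l.
rewrite -(@ltn_pmul2l (s + d)) ?addn_gt0 ?d0 ?orbT //; lia.
Qed.

(** Left of the vertex [(i + e, v)], the steeper second edge prolonged backwards runs below the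
    first edge, and [(i, x)] is above the first edge. *)
Lemma edge_before_second (v w i e k x : nat) :
  (v * i < x * (i + e))%N -> (v * (i + e + k) < w * (i + e))%N -> (0 < e)%N ->
  (k * v + v * e < k * x + w * e)%N.
Proof.
move=> lt1 lt2 e0.
have c1 : (k * (v * i) <= k * (x * (i + e)))%N by rewrite leq_mul2l ltnW ?orbT.
have c2 : (e * (v * (i + e + k)) < e * (w * (i + e)))%N by rewrite ltn_pmul2l.
rewrite -(@ltn_pmul2l (i + e)) ?addn_gt0 ?e0 ?orbT //; lia.
Qed.

Theorem theorem1p38 (n : nat) (a : nat -> int) (p q j1 j2 : nat)
  (a0an : a 0%N * a n != 0)
  (p_prime : prime p) (q_prime : prime q) (pq : p != q)
  (j1_le : (j1 <= n)%N) (j2_le : (j2 <= n)%N) (j12 : j1 != j2)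
  (j1_lt : (j1 < minn j2 (n - j2))%N)
  (i_low : forall i : nat, (0 <= i <= j1)%N -> nu p (a i) = 0%E)
  (i_mid : forall i : nat, (j1 < i < n)%N ->
     (nu p (a i) / (i - j1)%:R%:E > nu p (a n) / (n - j1)%:R%:E)%E)
  (i_top : (nu p (a n) > 0)%E)
  (ii_0 : nu q (a 0%N) = 0%E)
  (ii_low : forall i : nat, (0 < i < j2)%N ->
     (nu q (a i) / i%:R%:E > nu q (a j2) / j2%:R%:E)%E)
  (ii_j2 : (nu q (a j2) > 0)%E)
  (ii_high : forall i : nat, (j2 < i < n)%N ->
     (nu q (a i) >
        ((n - i)%:R / (n - j2)%:R)%:E * nu q (a j2)
        + ((i - j2)%:R / (n - j2)%:R)%:E * nu q (a n))%E)
  (ii_top : (nu q (a n) / n%:R%:E > nu q (a j2) / j2%:R%:E)%E)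
  (iii_p : gcdn (intval p (a n)) (n - j1) = 1%N)
  (iii_q1 : gcdn (intval q (a j2)) j2 = 1%N)
  (iii_q2 : gcdz ((intval q (a n))%:Z - (intval q (a j2))%:Z)
                 (n - j2)%N%:Z = 1) :
  irreducible_over_rat (int_poly a n).
Proof.
move: j1_lt; rewrite leq_min => /andP[j1j2 j1n].
have [a0 an] : a 0%N != 0 /\ a n != 0.
  by move: a0an; rewrite mulf_eq0 negb_or => /andP.
have j20 : (0 < j2)%N by apply: leq_ltn_trans j1j2.
have j2n : (j2 < n)%N by rewrite -subn_gt0; apply: leq_ltn_trans j1n.
have aj : a j2 != 0.
  (* If [a j2] vanished, the lower bound in [ii_top] would be [+oo]. *)
  apply: contraTneq ii_top => ->; rewrite /nu eqxx inver pnatr_eq0 gtn_eqF //.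
  by rewrite gt0_mulye ?lte_fin ?invr_gt0 ?ltr0n // ltNge leey.
have val0 r i : nu r (a i) = 0%E -> a i != 0 /\ intval r (a i) = 0%N.
  have [->|ai] := eqVneq (a i) 0; first by rewrite /nu eqxx.
  by rewrite nu_fin // => -[] /eqP; rewrite pnatr_eq0 => /eqP.
have [V0 v0] : (0 < intval p (a n))%N /\ (0 < intval q (a j2))%N.
  by move: i_top ii_j2; rewrite !nu_fin // !lte_fin !ltr0n.
have wtop : (intval q (a j2) * n < intval q (a n) * j2)%N.
  by move: ii_top; rewrite !nu_fin // ltr_divn // (ltn_trans j20).
have Ep : npedge p (n - j1) (intval p (a n))%:Z (int_poly a n) j1 (j1 + (n - j1)).
  have [aj1 vj1] := val0 _ _ (i_low j1 (leqnn _)).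
  have [k Ek] : exists k, n = (j1 + k)%N by exists (n - j1)%N; rewrite subnKC.
  rewrite subnKC //; apply: npedge_int_poly; rewrite ?j1_le ?leqnn //.
    by rewrite vj1; move: (intval _ _) => V; rewrite Ek addKn; lia.
  move=> i i_le ai ij1 i_n; rewrite vj1.
  have [ij|ji] := leqP i j1.
    (* Up to [j1] the valuations vanish and the slope is positive, so the weight decreases
       strictly. *)
    have [_ ->] := val0 _ _ (i_low i ij); rewrite mulr0 !sub0r ltrN2.
    by rewrite ltr_pM2l ?ltz_nat // ltn_neqAle ij1.
  have := i_mid i; rewrite ji ltn_neqAle i_n i_le => /(_ isT).
  rewrite !nu_fin // ltr_divn ?subn_gt0 ?(leq_trans ji) //.
  have [d Ed] : exists d, i = (j1 + d)%N by exists (i - j1)%N; rewrite subnKC // ltnW.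
  move: (intval p (a n)) (intval p (a i)) => V x; rewrite Ed Ek !addKn; clear; lia.
have [_ v00] := val0 _ _ ii_0.
have Eq1 : npedge q j2 (intval q (a j2))%:Z (int_poly a n) 0 j2.
  apply: npedge_int_poly => //; first by rewrite v00; move: (intval _ _) => v; lia.
  move=> i i_le ai i0 ij2; rewrite v00 !mulr0 subr0 subr_gt0 -!PoszM ltz_nat.
  have [ij|ji|ij] := ltngtP i j2; last by rewrite ij eqxx in ij2.
    have := ii_low i; rewrite ij lt0n i0 => /(_ isT).
    by rewrite !nu_fin // ltr_divn ?[(0 < i)%N]lt0n // (mulnC j2).
  have [->|i_n] := eqVneq i n; first by rewrite (mulnC j2).
  have := ii_high i; rewrite ji ltn_neqAle i_n i_le => /(_ isT).
  rewrite !nu_fin // ltr_nat_interpol ?subn_gt0 // => lt.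
  rewrite -[in ltnLHS](subnKC (ltnW ji)).
  apply: (@edge_beyond_first _ (intval q (a n)) (n - i)); rewrite ?subn_gt0 //.
    by rewrite addnBA ?subnK // ltnW.
  by rewrite subnKC ?subnKC // ltnW.
have Eq2 : npedge q (n - j2) ((intval q (a n))%:Z - (intval q (a j2))%:Z)
    (int_poly a n) j2 (j2 + (n - j2)).
  have [k Ek] : exists k, n = (j2 + k)%N by exists (n - j2)%N; rewrite subnKC.
  rewrite subnKC //; apply: npedge_int_poly; rewrite ?j2_le ?leqnn //.
    by move: (intval _ _) (intval _ _) => v w; rewrite Ek addKn; lia.
  move=> i i_le ai ij2 i_n.
  have [ij|ji|ij] := ltngtP i j2; last by rewrite ij eqxx in ij2.
    have lt : ((n - j2) * intval q (a j2) + intval q (a j2) * (j2 - i)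
        < (n - j2) * intval q (a i) + intval q (a n) * (j2 - i))%N.
      have [->|i0] := posnP i.
        by rewrite v00 muln0 subn0 (mulnC (n - j2)%N) -mulnDr subnK.
      have := ii_low i; rewrite ij i0 => /(_ isT).
      rewrite !nu_fin // ltr_divn // => lt.
      by apply: (@edge_before_second _ _ i); rewrite ?subn_gt0 ?subnKC // ltnW.
    move: lt; have [e Ee] : exists e, j2 = (i + e)%N.
      by exists (j2 - i)%N; rewrite subnKC // ltnW.
    move: (n - j2)%N (intval q (a n)) (intval q (a i)) (intval q (a j2)) => K w x v.
    rewrite Ee addKn; clear; lia.
  have := ii_high i; rewrite ji ltn_neqAle i_n i_le => /(_ isT).
  rewrite !nu_fin // ltr_nat_interpol ?subn_gt0 //.
  have [d Ed] : exists d, i = (j2 + d)%N by exists (i - j2)%N; rewrite subnKC // ltnW.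
  have [s Es] : exists s, n = (i + s)%N by exists (n - i)%N; rewrite subnKC.
  move: (intval q (a n)) (intval q (a i)) (intval q (a j2)) => w x v.
  have -> : (n - i)%N = s by rewrite Es addKn.
  have -> : (i - j2)%N = d by rewrite Ed addKn.
  have -> : (n - j2)%N = (d + s)%N by rewrite Es Ed -addnA addKn.
  rewrite Ed; clear; lia.
have sf := size_int_poly _ _ an.
have coq1 : coprimez j2%:Z (intval q (a j2))%:Z.
  by rewrite coprimezE coprime_sym /coprime iii_q1.
have coq2 : coprimez (n - j2)%N%:Z ((intval q (a n))%:Z - (intval q (a j2))%:Z).
  by rewrite /coprimez gcdzC iii_q2.
(* After cancelling the common product of [intval q (a j2)] and [j2], this is [wtop]: the polygon is
   strictly convex at [j2]. *)
have lt12 : (intval q (a j2))%:Z * (n - j2)%N%:Z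
    < ((intval q (a n))%:Z - (intval q (a j2))%:Z) * j2%:Z.
  move: wtop; rewrite -subzn //; move: (intval _ _) (intval _ _) => v w.
  by clear; lia.
have small g h : int_poly a n = g * h -> (size h <= j1.+1)%N -> size h = 1%N.
  move=> fE hj1; rewrite fE in sf Eq1 Eq2.
  apply: size_factor_two_edges lt12 Eq1 Eq2 _ _ _ => //; rewrite ?subn_gt0 ?subnKC //.
    exact: leq_trans hj1 _.
  exact: leq_trans hj1 _.
split; first by rewrite size_rat_int_poly sf ltnS (leq_trans j20).
(* By Gauss's lemma a rational divisor is a scalar multiple of an integer one, with an integer
   cofactor. *)
move=> d + /dvdpP_rat_int[g [c c0 dE] [h fE]].
rewrite dE size_scale // size_rat_int_poly => g1.
suff h1 : size h = 1%N.
  have [b b0 hE] : exists2 b, b != 0 & h = b%:P.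
    by move/eqP: h1 => /size_poly1P[b b0 ->]; exists b.
  rewrite fE hE mulrC mul_polyC map_polyZ.
  by rewrite (eqp_trans (eqp_scale _ c0)) // eqp_sym eqp_scale // intr_eq0.
have [g0 h0] : g != 0 /\ h != 0.
  by apply/andP; rewrite -negb_or -mulf_eq0 -fE -size_poly_gt0 sf.
have [] := npedge_factor p (n - j1) (intval p (a n))%:Z g h j1 p_prime.
- by rewrite subn_gt0 (leq_trans j1j2).
- by rewrite coprimezE coprime_sym /coprime iii_p.
- by rewrite -fE.
move=> L [U [L' [U' [/npedge_lt_size gU /npedge_lt_size hU eL]]]].
rewrite subnKC // => eU LU.
move: sf; rewrite fE size_mul // => sgh.
(* Since [U + U' = n], both [U] and [U'] are the full degrees. The factor without the edge thus has
   degree [L] or [L'], at most [j1], and [small] makes it constant; for [g] this contradicts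
   [g1]. *)
have [LgU|LhU] := LU.
  case/negP: g1; apply/eqP; apply: (small h); first by rewrite mulrC.
  move: sgh gU hU eU eL LgU; clear; move: (size g) (size h) => sg sh; lia.
apply: (small g) => //.
move: sgh gU hU eU eL LhU; clear; move: (size g) (size h) => sg sh; lia.
Qed.
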